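(* Let $\mathcal{F}$ be an $n$-periodic infinite frieze with quiddity sequence $q_{\mathcal{F}}=(a_1,a_2,\dots,a_n)$ and let $k\in\{1,2,\dots,n\}$. Then the $(n+1)$-tuple $$\hat q_{\mathcal{F}}^{\,n}=\begin{cases}(a_1+2,1)&\text{if }n=1,\\ (a_1,\dots,a_{k-1},a_k+1,1,a_{k+1}+1,a_{k+2},\dots,a_n)&\text{otherwise},\end{cases}$$ where indices are taken modulo $n$, is the quiddity sequence of an infinite frieze $\widehat{\mathcal{F}}^n$ of period $n+1$.
   Context: An infinite frieze is an array $(m_{ij})_{i,j\in\mathbb{Z},\,j-i\ge -2}$ of integers with $m_{i,i-2}=0$ and $m_{i,i-1}=1$ for all $i\in\mathbb{Z}$, $m_{ij}>0$ for all $j\ge i$, and $m_{ij}m_{i+1,j+1}-m_{i+1,j}m_{i,j+1}=1$ for all $j-i\ge -1$. For an integer $n\ge1$ it is $n$-periodic (of period $n$; $n$ need not be the minimal period) if $m_{ij}=m_{i+n,j+n}$ for all $i\le j$. The quiddity sequence of an $n$-periodic infinite frieze is the $n$-tuple $(a_1,\dots,a_n)$, determined up to cyclic equivalence, with $a_i=m_{ii}$. ''Indices modulo $n$'' in the tuple means: for $n\ge 2$ and $k=n$ the tuple is $(a_1+1,a_2,\dots,a_{n-1},a_n+1,1)$. *)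

(* Defs.v *)
From mathcomp Require Import all_boot all_order all_algebra.
Set Implicit Arguments.
Unset Strict Implicit.
Unset Printing Implicit Defensive.
Import GRing.Theory Num.Theory.
Local Open Scope ring_scope.

(* An array (m_ij), j - i >= -2, is encoded as a total function on int * int;
   its values at j < i - 2 are irrelevant and left unconstrained. *)
Definition infinite_frieze (m : int -> int -> int) : Prop :=
  [/\ forall i : int, m i (i - 2) = 0,
      forall i : int, m i (i - 1) = 1,
      forall i j : int, i <= j -> 0 < m i j
    & forall i j : int, -1 <= j - i ->
        m i j * m (i + 1) (j + 1) - m (i + 1) j * m i (j + 1) = 1].

(* n need not be the minimal period. *)
Definition periodic (n : nat) (m : int -> int -> int) : Prop :=
  forall i j : int, i <= j -> m i j = m (i + n%:Z) (j + n%:Z).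

Definition diagonal (n : nat) (m : int -> int -> int) : seq int :=
  [seq m i%:Z i%:Z | i <- iota 1 n].

(* The quiddity sequence of an n-periodic infinite frieze is only determined
   up to cyclic equivalence, i.e. up to rotation of (m_11, ..., m_nn). *)
Definition is_quiddity (n : nat) (m : int -> int -> int) (q : seq int) : Prop :=
  exists r : nat, q = rot r (diagonal n m).

(* The insertion of a 1 after the k-th entry, for 1 <= k <= n = size a.
   Sequences are 0-indexed, so a_i is nth 0 a i.-1.  For k = n >= 2 the entry
   a_(k+1) is a_1, and the result is (a_1 + 1, a_2, ..., a_(n-1), a_n + 1, 1). *)
Definition insert1 (k : nat) (a : seq int) : seq int :=
  let n := size a in
  let a_ i := nth 0 a i.-1 in
  if n == 1%N then [:: a_ 1%N + 2; 1]
  else if (k < n)%N then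
    take k.-1 a ++ [:: a_ k + 1; 1; a_ k.+1 + 1] ++ drop k.+1 a
  else
    a_ 1%N + 1 :: drop 1 (take n.-1 a) ++ [:: a_ n + 1; 1].

(* Main.v *)
(* An infinite frieze is a bi-infinite sequence of plane vectors v_i with
   det (v_i, v_(i+1)) = 1 and det (v_i, v_j) > 0 for i < j, read through
   m_ij = det (v_(i-1), v_(j+1)): the frieze rule is a Pluecker relation.
   Inserting v_i + v_(i+1) between v_i and v_(i+1) keeps both conditions, makes
   1 the quiddity entry of the new vector and adds 1 to the entries of its two
   neighbours.  Up to rotation the insertion happens after positions in nZ. *)
Require Import Defs.
From mathcomp Require Import all_boot all_order all_algebra.
From mathcomp Require Import zify ring.
Set Implicit Arguments.
Unset Strict Implicit.
Unset Printing Implicit Defensive.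
Import Order.TTheory GRing.Theory Num.Theory.
Local Open Scope ring_scope.

(** * Three-term recurrences along the rows and columns of a frieze *)

(** Uniqueness for a second-order recurrence: an identity between two solutions need only be checked
    at 0 and 1. *)
Lemma recurrence_eq0 (a x : int -> int) :
  (forall j, x (j + 1) + x (j - 1) = a j * x j) -> x 0 = 0 -> x 1 = 0 ->
  forall j, x j = 0.
Proof.
move=> rec x0 x1 j.
have up d : x d%:Z = 0 /\ x (d%:Z + 1) = 0.
  elim: d => [|d [IH1 IH2]]; first by rewrite add0r.
  have := rec (d%:Z + 1); rewrite addrK IH1 IH2 mulr0 addr0 => IH3.
  by have -> : d.+1%:Z = d%:Z + 1 by lia.
have down d : x (- d%:Z) = 0 /\ x (- d%:Z + 1) = 0.
  elim: d => [|d [IH1 IH2]]; first by rewrite oppr0 add0r.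
  have := rec (- d%:Z); rewrite IH1 IH2 mulr0 add0r => IH3.
  have -> : - d.+1%:Z = - d%:Z - 1 by lia.
  by rewrite subrK.
case: (leP 0 j) => j0.
  by have [+ _] := up (absz j); have -> : (absz j)%:Z = j by lia.
by have [+ _] := down (absz j); have -> : - (absz j)%:Z = j by lia.
Qed.

(** Induction on the distance [d] from row [j + 1]; each step cancels [m (i + 1) j], whose
    positivity requires [i + 1 <= j], hence two base cases. *)
Lemma frieze_recr (m : int -> int -> int) : infinite_frieze m ->
  forall i j : int, i - 1 <= j -> m i (j + 1) + m i (j - 1) = m (j + 1) (j + 1) * m i j.
Proof.
move=> [m0 m1 mpos mrel] i j le_ij.
have [d def_i] : exists d : nat, i = j + 1 - d%:Z.
  by exists (absz (j + 1 - i)%R); lia.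
elim: d i def_i le_ij => [|[|d] IHd] i def_i le_ij.
- have {def_i} -> : i = j + 1 by lia.
  have -> : j - 1 = j + 1 - 2 by lia.
  by have := m1 (j + 1); rewrite addrK => ->; rewrite m0 mulr1 addr0.
- have {def_i le_ij} -> : i = j by lia.
  have := mrel j j; have := m1 (j + 1); rewrite addrK m1 => ->.
  by move=> /(_ ltac:(lia)); lia.
have IH := IHd (i + 1) ltac:(lia) ltac:(lia).
have R1 := mrel i j ltac:(lia).
have := mrel i (j - 1) ltac:(lia); rewrite subrK => R2.
have p : 0 < m (i + 1) j by apply: mpos; lia.
apply: (mulfI (lt0r_neq0 p)).
(* R1 - R2 says that m _ (j + 1) + m _ (j - 1) is proportional to m _ j with the same
   ratio in rows i and i + 1. *)
have -> : m (i + 1) j * (m (j + 1) (j + 1) * m i j) =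
  m i j * (m (j + 1) (j + 1) * m (i + 1) j) by ring.
by rewrite -IH; lia.
Qed.

(** Reflection swaps rows and columns, so the left recurrence follows from the right one. *)
Lemma frieze_reflect (m : int -> int -> int) :
  infinite_frieze m -> infinite_frieze (fun i j => m (- j) (- i)).
Proof.
move=> [m0 m1 mpos mrel]; split=> [i|i|i j ij|i j ij].
- by rewrite -[RHS](m0 (2 - i)); congr m; lia.
- by rewrite -[RHS](m1 (1 - i)); congr m; lia.
- by apply: mpos; lia.
have := mrel (- (j + 1)) (- (i + 1)) ltac:(lia).
have -> : - (j + 1) + 1 = - j by lia.
have -> : - (i + 1) + 1 = - i by lia.
lia.
Qed.

Lemma frieze_recl (m : int -> int -> int) : infinite_frieze m ->
  forall i j : int, i - 1 <= j -> m (i - 1) j + m (i + 1) j = m (i - 1) (i - 1) * m i j.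
Proof.
move=> Fm i j le_ij.
have := frieze_recr (frieze_reflect Fm) (i := - j) (j := - i) ltac:(lia).
by rewrite !opprD !opprK.
Qed.

(** * Friezes as determinants of plane vectors *)

Definition det2 (u v : int * int) : int := u.1 * v.2 - v.1 * u.2.

(* Vertices of the triangulated strip carry vectors, and the entry m i j is
   attached to the arc from vertex i - 1 to vertex j + 1. *)
Lemma frieze_vectors (m : int -> int -> int) : infinite_frieze m ->
  exists v : int -> int * int,
    forall i j : int, i <= j -> det2 (v i) (v j) = m (i + 1) (j - 1).
Proof.
move=> Fm; have [m0 m1 _ _] := Fm.
(* The antisymmetric extension makes the recurrence in [j] valid on all of the integers; the
   branches agree at [i = j], where both are 0. *)
pose L i j : int := if i <= j then m (i + 1) (j - 1) else - m (j + 1) (i - 1).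
have Lle i j : i <= j -> L i j = m (i + 1) (j - 1) by rewrite /L => ->.
have Lge i j : j <= i -> L i j = - m (j + 1) (i - 1).
  rewrite /L => ji; case: (leP i j) => // ij.
  have {ij ji} -> : i = j by lia.
  have -> : j - 1 = j + 1 - 2 by lia.
  by rewrite m0.
have LN i j : L i j = - L j i.
  by case: (leP i j) => ij; [rewrite Lle ?Lge ?opprK|rewrite Lge ?Lle]; lia.
have L1 i : L i (i + 1) = 1.
  by rewrite Lle ?addrK; [have := m1 (i + 1); rewrite addrK | lia].
have L0 i : L i i = 0 by have := LN i i; lia.
have rec i j : L i (j + 1) + L i (j - 1) = m j j * L i j.
  case: (ltgtP i j) => ij.
  - rewrite !Lle; [|lia..].
    have := frieze_recr Fm (i := i + 1) (j := j - 1) ltac:(lia).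
    by rewrite subrK addrK.
  - rewrite !Lge; [|lia..].
    have := frieze_recl Fm (i := j + 1) (j := i - 1) ltac:(lia).
    by rewrite addrK subrK mulrN => <-; rewrite opprD addrC.
  - have := L1 (j - 1); rewrite subrK => H.
    by rewrite ij L1 L0 (LN j) H mulr0.
(* Rows 0 and 1 are the coordinates, so vectors 0 and 1 are (0, -1) and (1, 0). For fixed [i], both
   sides solve the same recurrence in [j]. *)
exists (fun j => (L 0 j, L 1 j)) => i j ij.
rewrite -Lle // {ij} /det2 /=; apply: subr0_eq; move: j.
have L10 : L 1 0 = -1 by rewrite LN; have := L1 0; rewrite add0r => ->.
have L01 : L 0 1 = 1 by have := L1 0; rewrite add0r.
apply: (recurrence_eq0 (a := fun j => m j j)) => [j||].
- transitivity (L 0 i * (L 1 (j + 1) + L 1 (j - 1)) -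
    (L 0 (j + 1) + L 0 (j - 1)) * L 1 i - (L i (j + 1) + L i (j - 1))).
    by ring.
  by rewrite !rec; ring.
- by rewrite L10 L0 (LN i 0); ring.
- by rewrite L01 L0 (LN i 1); ring.
Qed.

Lemma vectors_frieze (w : int -> int * int) :
  (forall i, det2 (w i) (w (i + 1)) = 1) ->
  (forall i j : int, i < j -> 0 < det2 (w i) (w j)) ->
  infinite_frieze (fun i j => det2 (w (i - 1)) (w (j + 1))).
Proof.
move=> w1 wpos; split=> [i|i|i j ij|i j _].
- have -> : i - 2 + 1 = i - 1 by lia.
  by rewrite /det2; ring.
- by rewrite subrK; have := w1 (i - 1); rewrite subrK.
- by apply: wpos; lia.
have := w1 (i - 1); have := w1 (j + 1); rewrite !subrK addrK /det2.
set a := w _; set b := w _; set c := w _; set d := w _ => H1 H2.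
(* Writing 1 as the product of the two consecutive determinants leaves a polynomial identity. *)
by rewrite -(mulr1 1) -{1}H1 -H2; ring.
Qed.

(** * Rotating the quiddity sequence *)

Lemma frieze_shift (n r : nat) (m : int -> int -> int) :
  infinite_frieze m -> periodic n m ->
  infinite_frieze (fun i j => m (i + r%:Z) (j + r%:Z)) /\
  periodic n (fun i j => m (i + r%:Z) (j + r%:Z)).
Proof.
move=> [m0 m1 mpos mrel] mper; split; first split=> [i|i|i j ij|i j ij].
- by rewrite addrAC m0.
- by rewrite addrAC m1.
- by apply: mpos; rewrite lerD2r.
- by rewrite ![_ + 1 + _]addrAC; apply: mrel; lia.
by move=> i j ij; rewrite mper ?lerD2r // ![_ + r%:Z + _]addrAC.
Qed.

(** Translating the frieze along its diagonal rotates the sequence; entries pushed past [n] wrap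
    around by periodicity. *)
Lemma rot_diagonal (n r : nat) (m : int -> int -> int) :
  infinite_frieze m -> periodic n m ->
  exists m' : int -> int -> int,
    [/\ infinite_frieze m', periodic n m' & rot r (diagonal n m) = diagonal n m'].
Proof.
move=> Fm mper; have size_diag m1 : size (diagonal n m1) = n.
  by rewrite size_map size_iota.
case: (leqP r n) => [le_rn|/ltnW lt_nr]; last first.
  by exists m; split=> //; rewrite rot_oversize ?size_diag.
have [Fm' mper'] := frieze_shift r Fm mper.
exists (fun i j => m (i + r%:Z) (j + r%:Z)); split=> //.
apply: (@eq_from_nth _ 0) => [|i]; rewrite ?size_rot !size_diag // => lt_in.
have nth_diag m1 d : (d < n)%N -> nth 0 (diagonal n m1) d = m1 d.+1%:Z d.+1%:Z.
  by move=> lt_dn; rewrite (nth_map 0%N) ?size_iota // nth_iota // add1n.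
rewrite nth_diag // /rot nth_cat size_drop size_diag.
case: ltnP => hi.
  rewrite nth_drop nth_diag; last by lia.
  by congr m; lia.
rewrite nth_take ?nth_diag; [|lia..].
by rewrite mper //; congr m; lia.
Qed.

(** Rotating by [k] moves the insertion point to the end, which reduces everything to the case where
    [k] is the length. *)
Lemma insert1_rot (k : nat) (a : seq int) : (1 <= k <= size a)%N ->
  exists r : nat, insert1 k a = rot r (insert1 (size a) (rot k a)).
Proof.
move=> /andP[k1]; rewrite leq_eqVlt => /orP[/eqP->|lt_ka].
  by exists 0%N; rewrite rot_size rot0.
exists (size a - k)%N.
rewrite /insert1 size_rot ltnn lt_ka.
have -> : (size a == 1%N) = false by lia.
have lt_k1a : (k.-1 < size a)%N by rewrite prednK // ltnW.
have := cat_take_drop k.-1 a.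
rewrite (drop_nth 0 lt_k1a) prednK // (drop_nth 0 lt_ka).
move=> def_a.
have size_A : size (take k.-1 a) = k.-1 by rewrite size_take; case: ltnP; lia.
(* Now [a] reads [A], [x], [y], [B], where [x] and [y] are the entries to be increased. *)
move: (nth 0 a k.-1) (nth 0 a k) (take k.-1 a) (drop k.+1 a) size_A def_a.
move=> x y A B size_A def_a.
have size_B : size B = (size a - k.+1)%N.
  by rewrite -def_a size_cat /= size_A; lia.
have -> : rot k a = y :: B ++ rcons A x.
  rewrite -def_a -cat_rcons -{1}(prednK k1) -size_A -(size_rcons A x).
  by rewrite rot_size_cat.
have size_yB : size (y :: B) = (size a - k)%N by rewrite /= size_B; lia.
have -> : take (size a).-1 (y :: B ++ rcons A x) = y :: B ++ A.
  rewrite -cats1 catA -cat_cons take_size_cat //= size_cat size_A size_B; lia.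
have -> : nth 0 (y :: B ++ rcons A x) (size a).-1 = x.
  rewrite -rcons_cat -rcons_cons nth_rcons /= size_cat size_A size_B.
  by case: ltnP; [lia | case: eqP => //; lia].
rewrite /= drop0 -catA -cat_cons.
have -> : (size a - k)%N = size (y + 1 :: B) by rewrite -size_yB.
by rewrite rot_size_cat -catA.
Qed.

(** * Periodic insertion of vectors *)

Lemma det2Dl (u u' v : int * int) : det2 (u + u') v = det2 u v + det2 u' v.
Proof. by rewrite /det2 /=; ring. Qed.

Lemma det2Dr (u v v' : int * int) : det2 u (v + v') = det2 u v + det2 u v'.
Proof. by rewrite /det2 /=; ring. Qed.

Lemma det2vv (u : int * int) : det2 u u = 0.
Proof. by rewrite /det2; ring. Qed.

(** Only determinants are periodic, not the vectors. The listed values of [w], from 0 to [n.+2], are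
    those that enter the new quiddity sequence. *)
Lemma insert_vectors (n : nat) (v : int -> int * int) : (0 < n)%N ->
  (forall i, det2 (v i) (v (i + 1)) = 1) ->
  (forall i j : int, i < j -> 0 < det2 (v i) (v j)) ->
  (forall i j, det2 (v (i + n%:Z)) (v (j + n%:Z)) = det2 (v i) (v j)) ->
  exists w : int -> int * int,
  [/\ forall i, det2 (w i) (w (i + 1)) = 1,
      forall i j : int, i < j -> 0 < det2 (w i) (w j),
      forall i j, det2 (w (i + n.+1%:Z)) (w (j + n.+1%:Z)) = det2 (w i) (w j),
      forall i : nat, (0 < i <= n)%N -> w i%:Z = v i%:Z
    & [/\ w 0%N%:Z = v 0%N%:Z + v 1%N%:Z, w n.+1%:Z = v n%:Z + v n.+1%:Z
        & w n.+2%:Z = v n.+1%:Z]].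
Proof.
move=> n0 v1 vpos vshift.
pose N := n.+1%:Z.
(* Multiples of N = n + 1 index the new vectors; f p is the old index of the
   vector at position p, or of the left neighbour of that vector if it is new. *)
pose f (p : int) := p - (p %/ N)%Z.
pose e (p : int) : int := ((p %% N)%Z == 0)%:Z.
pose w p := ((v (f p)).1 + e p * (v (f p + 1)).1,
             (v (f p)).2 + e p * (v (f p + 1)).2).
have w_det p q : det2 (w p) (w q) = det2 (v (f p)) (v (f q)) +
    e q * det2 (v (f p)) (v (f q + 1)) + e p * det2 (v (f p + 1)) (v (f q)) +
    e p * e q * det2 (v (f p + 1)) (v (f q + 1)).
  by rewrite /w /det2 /=; ring.
have fE (t s : int) : 0 <= s < N -> f (t * N + s) = t * n%:Z + s.
  by move=> s_lt; rewrite /f divzMDl // divz_small // addr0 /N; lia.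
have eE (t s : int) : 0 <= s < N -> e (t * N + s) = (s == 0)%:Z.
  by move=> s_lt; rewrite /e modzMDl modz_small.
have decomp p : exists t s : int, 0 <= s < N /\ p = t * N + s.
  exists (p %/ N)%Z, (p %% N)%Z; rewrite -divz_eq modz_ge0 //.
  by have := ltz_pmod p (d := N); rewrite ltz_nat => /(_ isT) ->.
(* Either position [p + 1] holds the next old vector, or it holds a new one whose left neighbour
   sits at [p]. *)
have f_step p : f (p + 1) = f p + 1 /\ e (p + 1) = 0 \/
    [/\ f (p + 1) = f p, e p = 0 & e (p + 1) = 1].
  have [t [s [s_lt ->]]] := decomp p.
  have [s_n|s_n] := eqVneq s n%:Z.
    have -> : t * N + s + 1 = (t + 1) * N + 0 by rewrite /N s_n; lia.
    by rewrite !fE ?eE //; right; split=> //; lia.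
  by rewrite -addrA !fE ?eE //; [|lia..]; left; split; lia.
(* New vectors are at least two positions apart, so [f] grows over any two steps, though not over
   every single one. *)
have f_lt (p q : int) : p + 1 < q -> f p < f q.
  have [t [s [s_lt ->]]] := decomp p; have [t' [s' [s_lt' ->]]] := decomp q.
  by rewrite !fE // /N => lt_pq; nia.
have f_period p : f (p + N) = f p + n%:Z.
  have [t [s [s_lt ->]]] := decomp p.
  have -> : t * N + s + N = (t + 1) * N + s by ring.
  by rewrite !fE //; ring.
have e_period p : e (p + N) = e p by rewrite /e modzDr.
have e_ge0 p : 0 <= e p by rewrite /e.
have vge0 (i j : int) : i <= j -> 0 <= det2 (v i) (v j).
  by rewrite le_eqVlt => /orP[/eqP->|/vpos/ltW //]; rewrite det2vv.
have w1 p : det2 (w p) (w (p + 1)) = 1.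
  by rewrite w_det; case: (f_step p) => [[-> ->]|[-> -> ->]];
    rewrite v1 det2vv; ring.
have w_old p i : f p = i -> e p = 0 -> w p = v i.
  by move=> <- e0; rewrite /w e0 !mul0r !addr0 -surjective_pairing.
have w_new p i : f p = i -> e p = 1 -> w p = v i + v (i + 1).
  by move=> <- e1; rewrite /w e1 !mul1r.
have addS (i : nat) : i%:Z + 1 = i.+1%:Z by lia.
exists w; split=> //.
- move=> p q lt_pq; have [->|q_p] := eqVneq q (p + 1); first by rewrite w1.
  have lt_f : f p < f q by apply: f_lt; lia.
  (* Since [f p + 1 <= f q], the last three terms of the expansion are nonnegative and the first is
     positive. *)
  rewrite w_det.
  do 3 (apply: ltr_wpDr; first by rewrite !mulr_ge0 ?e_ge0 ?vge0 //; lia).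
  exact: vpos.
- move=> i j; rewrite !w_det !f_period !e_period.
  by rewrite ![_ + n%:Z + 1]addrAC !vshift.
- move=> p p_n; have p_lt : 0 <= p%:Z < N by rewrite /N; lia.
  by apply: w_old; rewrite -[p%:Z]add0r -(mul0r N) ?fE ?eE //; lia.
have N_gt0 : 0 <= (0 : int) < N by rewrite /N; lia.
have N_gt1 : 0 <= (1 : int) < N by rewrite /N; lia.
split.
- by rewrite -(addS 0%N); apply: w_new; rewrite -[0%N%:Z]/(0 * N + 0) ?fE ?eE.
- have def_N : n.+1%:Z = 1 * N + 0 by rewrite mul1r addr0.
  by rewrite {1}def_N -addS; apply: w_new; rewrite ?fE ?eE ?mul1r ?addr0.
have def_N : n.+2%:Z = 1 * N + 1 by rewrite mul1r addS.
by rewrite def_N; apply: w_old; rewrite ?fE ?eE ?mul1r ?addS.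
Qed.

(** * Reading off the new quiddity sequence *)

(** For [n = 1] the single old entry has a new vector on both sides, hence the separate hypothesis
    with [+ 2]. *)
Lemma diagonal_insert1 (n : nat) (m m' : int -> int -> int) : (0 < n)%N ->
  (n = 1%N -> m' 1 1 = m 1 1 + 2) ->
  ((1 < n)%N -> m' 1 1 = m 1 1 + 1 /\ m' n%:Z n%:Z = m n%:Z n%:Z + 1) ->
  (forall i : nat, (1 < i < n)%N -> m' i%:Z i%:Z = m i%:Z i%:Z) ->
  m' n.+1%:Z n.+1%:Z = 1 ->
  diagonal n.+1 m' = insert1 n (diagonal n m).
Proof.
move=> n0 m'1 m'_ends m'_mid m'_last.
rewrite /diagonal /insert1 size_map size_iota ltnn.
have [n_1|n_1] := eqVneq n 1%N.
  by subst n; rewrite /= m'1 // m'_last.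
have [m'11 m'nn] := m'_ends ltac:(lia).
have -> : iota 1 n.+1 = 1%N :: iota 2 n.-2 ++ [:: n; n.+1].
  have -> : n.+1 = (1 + (n.-2 + 2))%N by lia.
  by rewrite !iotaD /=; congr [:: _ & _ ++ [:: _; _]]; lia.
have def_iota : iota 1 n = 1%N :: iota 2 n.-2 ++ [:: n].
  have {1}-> : n = (1 + (n.-2 + 1))%N by lia.
  by rewrite !iotaD /=; congr [:: _ & _ ++ [:: _]]; lia.
have -> : nth 0 [seq m i%:Z i%:Z | i <- iota 1 n] n.-1 = m n%:Z n%:Z.
  by rewrite (nth_map 0%N) ?size_iota ?nth_iota ?add1n ?prednK //; lia.
have -> : take n.-1 [seq m i%:Z i%:Z | i <- iota 1 n] =
    m 1 1 :: [seq m i%:Z i%:Z | i <- iota 2 n.-2].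
  rewrite def_iota map_cons map_cat -cat_cons take_size_cat //=.
  by rewrite size_map size_iota; lia.
rewrite def_iota /= drop0 m'11 map_cat /= m'nn m'_last.
congr (_ :: _ ++ _); apply/eq_in_map => i; rewrite mem_iota => i_n.
by apply: m'_mid; lia.
Qed.

Lemma insert_last (n : nat) (m : int -> int -> int) :
  (0 < n)%N -> infinite_frieze m -> periodic n m ->
  exists m' : int -> int -> int,
    [/\ infinite_frieze m', periodic n.+1 m'
      & diagonal n.+1 m' = insert1 n (diagonal n m)].
Proof.
move=> n0 Fm mper; have [_ m1 mpos _] := Fm.
have [v vm] := frieze_vectors Fm.
have v1 i : det2 (v i) (v (i + 1)) = 1.
  by rewrite vm ?addrK; [have := m1 (i + 1); rewrite addrK | lia].
have vpos (i j : int) : i < j -> 0 < det2 (v i) (v j).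
  move=> ij; have [->|ij1] := eqVneq j (i + 1); first by rewrite v1.
  by rewrite vm; [apply: mpos | ]; lia.
have vshift (a b : int) :
    det2 (v (a + n%:Z)) (v (b + n%:Z)) = det2 (v a) (v b).
  wlog le_ab : a b / a <= b => [IH|].
    case: (leP a b) => [/IH //|/ltW /IH].
    by rewrite /det2 => H; apply: oppr_inj; rewrite !opprB.
  (* [periodic] covers only entries with [i <= j], so gaps 0 and 1 are settled by the determinants 0
     and 1. *)
  have [->|b_a] := eqVneq b a; first by rewrite !det2vv.
  have [->|b_a1] := eqVneq b (a + 1); first by rewrite addrAC !v1.
  rewrite !vm ?lerD2r // (mper (a + 1)); last by lia.
  by congr m; lia.
have [w [w1 wpos wshift w_mid [w0 wn wn1]]] := insert_vectors n0 v1 vpos vshift.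
have v1S (i : nat) : det2 (v i%:Z) (v i.+1%:Z) = 1.
  by rewrite -[RHS](v1 i%:Z) -[i.+1]addn1 PoszD.
have v2 (i : nat) : det2 (v i%:Z) (v i.+2%:Z) = m i.+1%:Z i.+1%:Z.
  by rewrite vm ?lez_nat; [congr m; lia | lia].
exists (fun i j => det2 (w (i - 1)) (w (j + 1))); split.
- exact: vectors_frieze.
- by move=> i j _; rewrite ![_ + n.+1%:Z + _]addrAC wshift.
have wE (i : nat) : det2 (w (i.+1%:Z - 1)) (w (i.+1%:Z + 1)) =
    det2 (w i%:Z) (w i.+2%:Z).
  by congr (det2 (w _) (w _)); lia.
apply: diagonal_insert1 => //.
(* The determinant of [v 0 + v 1] and [v 1 + v 2] expands to 1 + [m 1 1] + 0 + 1. *)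
- move=> n_1; subst n; rewrite (wE 0%N) w0 wn det2Dl !det2Dr !v1S v2 det2vv.
  by ring.
- move=> n_gt1; rewrite (wE 0%N) w0 w_mid // det2Dl v2 v1S; split=> //.
  case: n n_gt1 {n0 vshift wshift mper} w_mid wn {w0 wn1} => // n n_gt1 w_mid wn.
  by rewrite wE wn w_mid ?det2Dr ?v2 ?v1S 1?addrC //; lia.
- move=> [|i] // i_n; rewrite wE !w_mid; [exact: v2|lia..].
- by rewrite wE wn1 w_mid ?v1S //; lia.
Qed.

Theorem proposition2p4 (n : nat) (F : int -> int -> int) (q : n.-tuple int)
    (k : nat) (hn : (1 <= n)%N) (hk : (1 <= k <= n)%N)
    (hF : infinite_frieze F) (hper : periodic n F) (hq : is_quiddity n F q) :
  exists F' : int -> int -> int,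
    [/\ infinite_frieze F', periodic n.+1 F'
      & is_quiddity n.+1 F' (insert1 k q)].
Proof.
have [r def_q] := hq.
(* The first translation makes [q] the diagonal itself; the second, by [k], puts the insertion at
   the end. The rotation back is absorbed by [is_quiddity]. *)
have [F1 [hF1 hper1 def_q1]] := rot_diagonal r hF hper.
have [F2 [hF2 hper2 def_q2]] := rot_diagonal k hF1 hper1.
have [F' [hF' hper' def_q']] := insert_last hn hF2 hper2.
exists F'; split=> //; rewrite /is_quiddity.
have [s ->] : exists s, insert1 k q = rot s (insert1 (size q) (rot k q)).
  by apply: insert1_rot; rewrite size_tuple.
by exists s; rewrite size_tuple def_q' -def_q2 -def_q1 -def_q.
Qed.
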